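(* Let $f$ be the metric coefficient of a spacetime in class $\mathcal{S}_{\text{ext}}$, $v(r):=f(r)/r^2$, and let $\lambda^2=\lambda_*^2:=v(r_* )$. Consider the photon surface ODE $$\Big(\frac{dr}{dt}\Big)^2=\frac{f(r)^2\,(\lambda^2r^2-f(r))}{\lambda^2r^2}.\qquad(\ast)$$ The photon sphere $r\equiv r_*$ is the unique smooth solution of $(\ast)$ with $\lambda^2=\lambda_*^2$ and $r(0)=r_0=r_*$. Moreover, there exist two smooth, strictly increasing, global solutions $r^+_*$ and $R^+_*$ of $(\ast)$ with $\lambda^2=\lambda_*^2$ with respective ranges $r^+_*(\mathbb{R})=(r_H,r_* )$ and $R^+_*(\mathbb{R})=(r_*,\infty)$ such that the following holds: For any initial value $r_H<r_0<r_*$, there exist precisely two smooth, global solutions $r^\pm_{r_0}$ of $(\ast)$ with $\lambda^2=\lambda_*^2$ and initial value $r(0)=r_0$; these are time-reflections of each other and $r^+_{r_0}$ is a time-translation of $r^+_*$. For any initial value $r_0>r_*$, there exist precisely two smooth, global solutions $R^\pm_{r_0}$ of $(\ast)$ with $\lambda^2=\lambda_*^2$ and initial value $r(0)=r_0$; these are time-reflections of each other and $R^+_{r_0}$ is a time-translation of $R^+_*$. Solving the initial value problem for $(\ast)$ at generic $t_0$ rather than at $t_0=0$ results only in further time-translations. Here, uniqueness is meant locally in comparison with other local $C^1$-solutions. The solutions behave as follows: $r^+_{r_0}$ is strictly increasing, tends to $r_H$ as $t\to-\infty$ and to $r_*$ as $t\to\infty$, while $r^-_{r_0}$ is strictly decreasing,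 tends to $r_*$ as $t\to-\infty$ and to $r_H$ as $t\to\infty$; $R^+_{r_0}$ is strictly increasing, tends to $r_*$ as $t\to-\infty$ and to $\infty$ as $t\to\infty$, while $R^-_{r_0}$ is strictly decreasing, tends to $\infty$ as $t\to-\infty$ and to $r_*$ as $t\to\infty$; for $r_0=r_*$ one has the photon sphere $r\equiv r_*$.
   Context: Class $\mathcal{S}$: Lorentzian manifolds $(\mathbb{R}\times\mathcal{I}\times\mathbb{S}^{n-1},\ -f(r)dt^2+\frac{1}{f(r)}dr^2+r^2\Omega)$ with $\mathcal{I}\subseteq(0,\infty)$ an open interval, $f\colon\mathcal{I}\to(0,\infty)$ smooth (the metric coefficient), $\Omega$ the round metric on $\mathbb{S}^{n-1}$. Class $\mathcal{S}_{\text{ext}}$: those members of $\mathcal{S}$ for which $\mathcal{I}=(r_H,\infty)$ for some $r_H>0$ and: (1) $f$ extends $C^3$ to $r_H$ with $f(r_H)=0$, $f'(r_H)>0$; (2) $f(r)\to1$ and $f'(r)\to0$ as $r\to\infty$; (3) $v(r)=f(r)/r^2$ is strictly increasing on $(r_H,r_* )$ up to one global maximum at some $r_*\in\mathcal{I}$ and then strictly decreasing on $(r_*,\infty)$. Solutions $r=r(t)$ take values in $(r_H,\infty)$; global means defined for all $t\in\mathbb{R}$. A time-translation of a function $r(t)$ is $t\mapsto r(t+c)$, $c\in\mathbb{R}$; its time-reflection is $t\mapsto r(-t)$. *)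

(* Defs.v *)
From Stdlib Require Import Reals.
From Coquelicot Require Import Coquelicot.
Open Scope R_scope.

Definition open_interval (a b : Rbar) (x : R) : Prop :=
  Rbar_lt a x /\ Rbar_lt x b.

(* Meant for open D only: derivatives at points of D are two-sided. *)
Definition smooth_on (D : R -> Prop) (g : R -> R) : Prop :=
  forall (k : nat) (x : R), D x -> ex_derive_n g k x.

(* C^k on a set D without isolated points, with all derivatives and limits
   taken within D, so one-sided at an endpoint of D that belongs to D. *)
Fixpoint Ck_within (k : nat) (D : R -> Prop) (g : R -> R) : Prop :=
  match k with
  | O => forall x, D x -> continue_in g D x
  | S k' => exists g' : R -> R,
      (forall x, D x -> D_in g g' D x) /\ Ck_within k' D g'
  end.

Definition strictly_increasing_on (D : R -> Prop) (g : R -> R) : Prop :=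
  forall x y, D x -> D y -> x < y -> g x < g y.

Definition strictly_decreasing_on (D : R -> Prop) (g : R -> R) : Prop :=
  forall x y, D x -> D y -> x < y -> g y < g x.

(* A member of the class S. The manifold R x I x S^(n-1) and its metric are
   determined by n, the end points of the interval I, and the metric
   coefficient f. The values of f outside I are irrelevant. *)
Record spacetime : Type := Spacetime {
  dim : nat;
  inner : R;
  outer : Rbar;
  metric_coef : R -> R;
  dim_pos : (1 <= dim)%nat;
  inner_ge0 : 0 <= inner;
  inner_lt_outer : Rbar_lt inner outer;
  metric_coef_smooth : smooth_on (open_interval inner outer) metric_coef;
  metric_coef_pos : forall r, open_interval inner outer r -> 0 < metric_coef r
}.

Definition radii (M : spacetime) : R -> Prop :=
  open_interval (inner M) (outer M).

(* Vectors of R^n are the functions nat -> R vanishing from index n on. The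
   sum below has the n terms of index 0, ..., n-1, since n >= 1. *)
Definition in_Rn (n : nat) (x : nat -> R) : Prop :=
  forall i, (n <= i)%nat -> x i = 0.

Definition dot (n : nat) (x y : nat -> R) : R :=
  sum_f_R0 (fun i => x i * y i) (pred n).

Record point (M : spacetime) : Type := Point {
  time : R;
  radius : R;
  direction : nat -> R;
  radius_in : radii M radius;
  direction_in : in_Rn (dim M) direction;
  direction_unit : dot (dim M) direction direction = 1
}.

Record tangent (M : spacetime) (p : point M) : Type := Tangent {
  dtime : R;
  dradius : R;
  ddirection : nat -> R;
  ddirection_in : in_Rn (dim M) ddirection;
  ddirection_orth : dot (dim M) (direction M p) ddirection = 0
}.

(* - f(r) dt^2 + dr^2 / f(r) + r^2 Omega, with the round metric Omega induced
   by the inner product of R^n. *)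
Definition lorentz_metric (M : spacetime) (p : point M) (X Y : tangent M p) : R :=
  let r := radius M p in
  let f := metric_coef M in
  - f r * dtime M p X * dtime M p Y
  + / f r * dradius M p X * dradius M p Y
  + r ^ 2 * dot (dim M) (ddirection M p X) (ddirection M p Y).

Definition v (M : spacetime) (r : R) : R := metric_coef M r / r ^ 2.

Definition class_S_ext (M : spacetime) (r_H r_star : R) : Prop :=
  inner M = r_H /\ outer M = p_infty /\ 0 < r_H /\
  (exists F : R -> R,
     (forall r, r_H < r -> F r = metric_coef M r) /\
     Ck_within 3 (fun r => r_H <= r) F /\
     F r_H = 0 /\
     exists F' : R -> R, D_in F F' (fun r => r_H <= r) r_H /\ 0 < F' r_H) /\
  is_lim (metric_coef M) p_infty 1 /\
  is_lim (Derive (metric_coef M)) p_infty 0 /\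
  radii M r_star /\
  strictly_increasing_on (open_interval r_H r_star) (v M) /\
  (forall r, radii M r -> r <> r_star -> v M r < v M r_star) /\
  strictly_decreasing_on (open_interval r_star p_infty) (v M).

Definition photon_surface_ODE (M : spacetime) (lambda : R) (r : R -> R) (t : R)
  : Prop :=
  let f := metric_coef M in
  (Derive r t) ^ 2 =
    (f (r t)) ^ 2 * (lambda ^ 2 * (r t) ^ 2 - f (r t))
    / (lambda ^ 2 * (r t) ^ 2).

(* A C^1 solution on the open time interval (a,b). *)
Definition local_C1_solution (M : spacetime) (lambda : R) (a b : Rbar)
  (r : R -> R) : Prop :=
  forall t, open_interval a b t ->
    ex_derive r t /\ continuous (Derive r) t /\
    radii M (r t) /\ photon_surface_ODE M lambda r t.

Definition smooth_global_solution (M : spacetime) (lambda : R) (r : R -> R)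
  : Prop :=
  smooth_on (fun _ => True) r /\
  forall t, radii M (r t) /\ photon_surface_ODE M lambda r t.

(* Uniqueness is local, among all C^1 solutions on open intervals around t0. *)
Definition unique_solution (M : spacetime) (lambda t0 r0 : R) (s : R -> R)
  : Prop :=
  smooth_global_solution M lambda s /\ s t0 = r0 /\
  forall (a b : Rbar) (q : R -> R),
    open_interval a b t0 -> local_C1_solution M lambda a b q -> q t0 = r0 ->
    forall t, open_interval a b t -> q t = s t.

(* The two solutions differ on every interval around t0, and each local C^1
   solution agrees with one of them on all of its interval. *)
Definition precisely_two_solutions (M : spacetime) (lambda t0 r0 : R)
  (s1 s2 : R -> R) : Prop :=
  smooth_global_solution M lambda s1 /\ s1 t0 = r0 /\
  smooth_global_solution M lambda s2 /\ s2 t0 = r0 /\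
  (forall a b : Rbar, open_interval a b t0 ->
     exists t, open_interval a b t /\ s1 t <> s2 t) /\
  (forall (a b : Rbar) (q : R -> R),
     open_interval a b t0 -> local_C1_solution M lambda a b q -> q t0 = r0 ->
     (forall t, open_interval a b t -> q t = s1 t) \/
     (forall t, open_interval a b t -> q t = s2 t)).

Definition time_translate (c : R) (r : R -> R) : R -> R := fun t => r (t + c).

Definition time_reflect (r : R -> R) : R -> R := fun t => r (- t).

Definition is_time_translation (q r : R -> R) : Prop :=
  exists c : R, forall t, q t = time_translate c r t.

Definition is_time_reflection (q r : R -> R) : Prop :=
  forall t, q t = time_reflect r t.

Definition has_range (r : R -> R) (a b : Rbar) : Prop :=
  forall y, (exists t, r t = y) <-> open_interval a b y.

(* Main.v *)
(** At [lambda ^ 2 = v(r_star)] the ODE reads [r'^2 = G(r)] with [G >= 0]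
    vanishing exactly at [r_star]. There [G] has a double zero, so
    [|r'| <= C |r - r_star|] and by Gronwall no other solution ever meets
    [r_star]. On either side of [r_star], [r'] therefore keeps its sign and
    [r' = sqrt(G(r))] or [r' = - sqrt(G(r))], which is solved by inverting a
    primitive [T] of [1 / sqrt G]. [T] maps each side onto the whole line:
    [sqrt G] is at most linear at [r_star]; and [sqrt G <= f], which is at
    most linear at [r_H] and bounded at infinity. *)
From Stdlib Require Import Reals Lra ClassicalEpsilon FunctionalExtensionality.
From Coquelicot Require Import Coquelicot.
(* Last, since Stdlib.Reals also has an [open_interval]. *)
Require Import Defs.
Open Scope R_scope.

(** The equation is quadratic in [r'], so a solution could a priori pass from one root to the other
    wherever [r'] vanishes, which is at [r_star] only; and [sqrt] is not differentiable at 0. Hence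
    the root is taken on the two open sides alone, and at [r_star] uniqueness is drawn from the
    squared equation itself. The double zero comes without differentiating [f]: [lambda ^ 2] is the
    maximum of [v], so [G >= 0], and a nonnegative differentiable function has zero slope at an
    interior zero. Globality rests on upper bounds for the speed: they keep a solution from reaching
    an end of its interval in finite time, in either time direction. *)

(** * Intervals with possibly infinite ends, and mean value arguments *)

Lemma open_interval_convex (a b : Rbar) (x y z : R) :
  open_interval a b x -> open_interval a b y -> x <= z <= y ->
  open_interval a b z.
Proof.
  unfold open_interval; destruct a, b; simpl; intros; try lra; tauto.
Qed.

Lemma open_interval_convex_minmax (a b : Rbar) (x y z : R) :
  open_interval a b x -> open_interval a b y -> Rmin x y <= z <= Rmax x y ->
  open_interval a b z.
Proof.
  intros Hx Hy Hz.
  destruct (Rle_dec x y).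
  - rewrite Rmin_left, Rmax_right in Hz by lra.
    exact (open_interval_convex a b x y z Hx Hy Hz).
  - rewrite Rmin_right, Rmax_left in Hz by lra.
    exact (open_interval_convex a b y x z Hy Hx Hz).
Qed.

Lemma open_open_interval (a b : Rbar) : open (open_interval a b).
Proof.
  intros x [Ha Hb].
  exact (filter_and _ _ (open_Rbar_gt a x Ha) (open_Rbar_lt b x Hb)).
Qed.

Lemma open_interval_neighbourhood (a b : Rbar) (x : R) :
  open_interval a b x ->
  exists d : posreal, forall y, Rabs (y - x) < d -> open_interval a b y.
Proof.
  intros Hx; destruct (open_open_interval a b x Hx) as [d Hd].
  exists d; intros y Hy; apply Hd; exact Hy.
Qed.

Lemma open_interval_exists_right (a b : Rbar) (x : R) :
  open_interval a b x -> exists y, x < y /\ open_interval a b y.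
Proof.
  intros Hx; destruct (open_interval_neighbourhood a b x Hx) as [d Hd].
  pose proof (cond_pos d).
  exists (x + d / 2); split; [lra | apply Hd].
  rewrite Rabs_right; lra.
Qed.

Lemma continuous_epsilon (f : R -> R) (x e : R) :
  continuous f x -> 0 < e ->
  exists d, 0 < d /\ forall y, Rabs (y - x) < d -> Rabs (f y - f x) < e.
Proof.
  intros Hf He.
  destruct (proj1 (filterlim_locally f (f x)) Hf (mkposreal e He)) as [d Hd].
  exists d; split; [apply cond_pos | exact Hd].
Qed.

Lemma is_derive_continuity_pt (f : R -> R) (x l : R) :
  is_derive f x l -> continuity_pt f x.
Proof.
  intros H; apply continuity_pt_filterlim, (ex_derive_continuous f).
  exists l; exact H.
Qed.

Lemma mean_value (f df : R -> R) (a b : R) :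
  (forall x, Rmin a b <= x <= Rmax a b -> is_derive f x (df x)) ->
  exists c, Rmin a b <= c <= Rmax a b /\ f b - f a = df c * (b - a).
Proof.
  intros H; apply MVT_gen; intros x Hx.
  - apply H; lra.
  - apply is_derive_continuity_pt with (df x), H, Hx.
Qed.

Lemma nondecreasing_of_derive_nonneg (f df : R -> R) (a b : R) :
  a <= b -> (forall x, a <= x <= b -> is_derive f x (df x)) ->
  (forall x, a <= x <= b -> 0 <= df x) -> f a <= f b.
Proof.
  intros Hab Hf Hdf.
  destruct (mean_value f df a b) as [c [Hc Heq]];
    rewrite ?Rmin_left, ?Rmax_right in * by lra; [exact Hf |].
  specialize (Hdf c Hc).
  pose proof (Rmult_le_pos (df c) (b - a) Hdf ltac:(lra)); lra.
Qed.

(** The intermediate value theorem on an interval whose ends may be infinite. It serves twice: [r']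
    keeps its sign along a solution off [r_star], and so does [r - r_star]. *)
Lemma nonvanishing_same_sign (a b : Rbar) (f : R -> R) (s t : R) :
  (forall x, open_interval a b x -> continuous f x) ->
  (forall x, open_interval a b x -> f x <> 0) ->
  open_interval a b s -> open_interval a b t -> 0 < f s -> 0 < f t.
Proof.
  intros Hc Hn Hs Ht Hfs.
  destruct (Rtotal_order (f t) 0) as [Hft | [Hft | Hft]];
    [exfalso | now destruct (Hn t Ht) | exact Hft].
  assert (Hst : s <> t) by (intros ->; lra).
  assert (Hcont : forall x y z, open_interval a b x -> open_interval a b y ->
            x <= z <= y -> continuity_pt f z).
  { intros x y z Hx Hy Hz; apply continuity_pt_filterlim, Hc.
    exact (open_interval_convex a b x y z Hx Hy Hz). }
  destruct (Rlt_dec t s) as [Hlt | Hlt].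
  - destruct (Ranalysis5.IVT_interv f t s) as [z [Hz Hz0]]; try lra.
    + intros z Hz; exact (Hcont t s z Ht Hs Hz).
    + exact (Hn z (open_interval_convex a b t s z Ht Hs Hz) Hz0).
  - destruct (Ranalysis5.IVT_interv (fun x => - f x) s t) as [z [Hz Hz0]];
      try lra.
    + intros z Hz; apply continuity_pt_opp; exact (Hcont s t z Hs Ht Hz).
    + apply (Hn z (open_interval_convex a b s t z Hs Ht Hz)); lra.
Qed.

(** * Smoothness by towers of derivatives *)

(** Derivatives are given as functions rather than as iterated [Derive_n], so that sum, product,
    inverse and composition are inductions on [k]. On an open [D], to have this for all [k] is
    [smooth_on]. *)
Fixpoint differentiable_upto (k : nat) (D : R -> Prop) (f : R -> R) : Prop :=
  match k with
  | O => True
  | S k' => exists f' : R -> R,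
      (forall x, D x -> is_derive f x (f' x)) /\ differentiable_upto k' D f'
  end.

Lemma differentiable_upto_pred (k : nat) (D : R -> Prop) (f : R -> R) :
  differentiable_upto (S k) D f -> differentiable_upto k D f.
Proof.
  revert f; induction k as [| k IH]; intros f; [easy |].
  intros [f' [Hf Hf']]; exists f'; split; [exact Hf | apply IH, Hf'].
Qed.

Lemma differentiable_upto_subset (k : nat) (D E : R -> Prop) (f : R -> R) :
  (forall x, E x -> D x) -> differentiable_upto k D f ->
  differentiable_upto k E f.
Proof.
  intros HED; revert f; induction k as [| k IH]; intros f; [easy |].
  intros [f' [Hf Hf']]; exists f'; split; auto.
Qed.

Lemma smooth_on_differentiable_upto (k : nat) (D : R -> Prop) (f : R -> R) :
  smooth_on D f -> differentiable_upto k D f.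
Proof.
  revert f; induction k as [| k IH]; intros f Hf; [easy |].
  exists (Derive f); split.
  - intros x Hx; apply Derive_correct; exact (Hf 1%nat x Hx).
  - apply IH; intros [| m] x Hx; [exact I | simpl].
    apply ex_derive_ext with (Derive_n f (S m)).
    + intros y; change (Derive f) with (Derive_n f 1).
      now rewrite Derive_n_comp, PeanoNat.Nat.add_1_r.
    + exact (Hf (S (S m)) x Hx).
Qed.

Lemma differentiable_upto_smooth_on (D : R -> Prop) (f : R -> R) :
  open D -> (forall k, differentiable_upto k D f) -> smooth_on D f.
Proof.
  intros HD Hf k; specialize (Hf k); revert f Hf.
  induction k as [| [| k] IH]; intros f Hk x Hx; [exact I | |];
    destruct Hk as [f' [Hf Hf']].
  - exists (f' x); exact (Hf x Hx).
  - apply (ex_derive_ext_loc (Derive_n f' k)); [| exact (IH f' Hf' x Hx)].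
    revert x Hx; apply locally_open; [exact HD |]; intros x Hx.
    rewrite <- PeanoNat.Nat.add_1_r, <- Derive_n_comp; apply Derive_n_ext_loc.
    revert x Hx; apply locally_open; [exact HD |]; intros x Hx.
    symmetry; apply is_derive_unique, Hf, Hx.
Qed.

Lemma differentiable_upto_const (k : nat) (D : R -> Prop) (c : R) :
  differentiable_upto k D (fun _ => c).
Proof.
  revert c; induction k as [| k IH]; intros c; [easy |].
  exists (fun _ => 0); split; [| apply IH].
  intros x _; apply @is_derive_const.
Qed.

Lemma differentiable_upto_id (k : nat) (D : R -> Prop) :
  differentiable_upto k D (fun x => x).
Proof.
  destruct k; [easy |].
  exists (fun _ => 1); split; [| apply differentiable_upto_const].
  intros x _; apply @is_derive_id.
Qed.

Lemma differentiable_upto_plus (k : nat) (D : R -> Prop) (f g : R -> R) :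
  differentiable_upto k D f -> differentiable_upto k D g ->
  differentiable_upto k D (fun x => f x + g x).
Proof.
  revert f g; induction k as [| k IH]; intros f g; [easy |].
  intros [f' [Hf Hf']] [g' [Hg Hg']].
  exists (fun x => f' x + g' x); split; [| now apply IH].
  intros x Hx; apply @is_derive_plus; auto.
Qed.

Lemma differentiable_upto_mult (k : nat) (D : R -> Prop) (f g : R -> R) :
  differentiable_upto k D f -> differentiable_upto k D g ->
  differentiable_upto k D (fun x => f x * g x).
Proof.
  revert f g; induction k as [| k IH]; intros f g; [easy |].
  intros Hf Hg.
  pose proof (differentiable_upto_pred k D f Hf) as Hf0.
  pose proof (differentiable_upto_pred k D g Hg) as Hg0.
  destruct Hf as [f' [Hf Hf']], Hg as [g' [Hg Hg']].
  exists (fun x => f' x * g x + f x * g' x); split.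
  - intros x Hx; apply @is_derive_mult; auto; intros; apply Rmult_comm.
  - apply differentiable_upto_plus; apply IH; assumption.
Qed.

Lemma differentiable_upto_minus (k : nat) (D : R -> Prop) (f g : R -> R) :
  differentiable_upto k D f -> differentiable_upto k D g ->
  differentiable_upto k D (fun x => f x - g x).
Proof.
  revert f g; induction k as [| k IH]; intros f g; [easy |].
  intros [f' [Hf Hf']] [g' [Hg Hg']].
  exists (fun x => f' x - g' x); split; [| now apply IH].
  intros x Hx; apply @is_derive_minus; auto.
Qed.

(** The derivative [- f' / f ^ 2] contains [/ f] again, only one order lower, so the induction is on
    the order with [f] fixed. The square root below works in the same way, its derivative being
    [f' / (2 * sqrt f)]. *)
Lemma differentiable_upto_inv (k : nat) (D : R -> Prop) (f : R -> R) :
  (forall x, D x -> f x <> 0) -> differentiable_upto k D f ->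
  differentiable_upto k D (fun x => / f x).
Proof.
  intros Hf0; induction k as [| k IH]; [easy |].
  intros Hf; pose proof (IH (differentiable_upto_pred k D f Hf)) as Hi.
  destruct Hf as [f' [Hf Hf']].
  exists (fun x => (0 - f' x) * (/ f x * / f x)); split.
  - intros x Hx.
    replace ((0 - f' x) * (/ f x * / f x)) with (- f' x / f x ^ 2)
      by (field; auto).
    apply is_derive_inv; auto.
  - apply differentiable_upto_mult.
    + apply differentiable_upto_minus; [apply differentiable_upto_const | auto].
    + apply differentiable_upto_mult; auto.
Qed.

Lemma differentiable_upto_sqrt (k : nat) (D : R -> Prop) (f : R -> R) :
  (forall x, D x -> 0 < f x) -> differentiable_upto k D f ->
  differentiable_upto k D (fun x => sqrt (f x)).
Proof.
  intros Hf0; induction k as [| k IH]; [easy |].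
  intros Hf; pose proof (IH (differentiable_upto_pred k D f Hf)) as Hi.
  destruct Hf as [f' [Hf Hf']].
  exists (fun x => f' x * / (2 * sqrt (f x))); split.
  - intros x Hx; apply is_derive_sqrt; auto.
  - apply differentiable_upto_mult; [exact Hf' |].
    apply differentiable_upto_inv.
    + intros x Hx; pose proof (sqrt_lt_R0 _ (Hf0 x Hx)); lra.
    + apply differentiable_upto_mult; [apply differentiable_upto_const | auto].
Qed.

Lemma differentiable_upto_comp (k : nat) (D E : R -> Prop) (f u : R -> R) :
  (forall x, E x -> D (u x)) -> differentiable_upto k D f ->
  differentiable_upto k E u -> differentiable_upto k E (fun x => f (u x)).
Proof.
  intros HED; revert f; induction k as [| k IH]; intros f; [easy |].
  intros [f' [Hf Hf']] Hu.
  pose proof (differentiable_upto_pred k E u Hu) as Hu0.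
  destruct Hu as [u' [Hu Hu']].
  exists (fun x => u' x * f' (u x)); split.
  - intros x Hx; apply @is_derive_comp; auto.
  - apply differentiable_upto_mult; auto.
Qed.

(** A bootstrap: if [r] has [k] derivatives then so has [r' = g(r)], hence [r] has [k + 1]. *)
Lemma differentiable_upto_autonomous (k : nat) (D E : R -> Prop) (g r : R -> R) :
  (forall n, differentiable_upto n D g) ->
  (forall t, E t -> D (r t) /\ is_derive r t (g (r t))) ->
  differentiable_upto k E r.
Proof.
  intros Hg Hr; induction k as [| k IH]; [easy |].
  exists (fun t => g (r t)); split; [intros t Ht; now apply Hr |].
  apply differentiable_upto_comp with D; [intros t Ht; now apply Hr | auto | auto].
Qed.

(** * Solving [r' = g(r)] by inverting a primitive of [1 / g] *)

Lemma primitive_exists (a b : Rbar) (h : R -> R) (c : R) :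
  open_interval a b c -> (forall x, open_interval a b x -> continuous h x) ->
  exists H : R -> R, forall x, open_interval a b x -> is_derive H x (h x).
Proof.
  intros Hc Hh; exists (fun x => RInt h c x); intros x Hx.
  apply @is_derive_RInt with c; [| exact (Hh x Hx)].
  revert x Hx; apply locally_open; [apply open_open_interval |]; intros x Hx.
  apply @RInt_correct, @ex_RInt_continuous; intros z Hz.
  exact (Hh z (open_interval_convex_minmax a b c x z Hc Hx Hz)).
Qed.

(** As [1 / g x >= 1 / (C * (b - x))], the function [T x + ln (b - x) / C] is nondecreasing, so [T]
    diverges at least logarithmically at [b]. *)
Lemma unbounded_above_at_finite_end (p b C : R) (g T : R -> R) :
  p < b -> 0 < C ->
  (forall x, p <= x < b -> 0 < g x <= C * (b - x)) ->
  (forall x, p <= x < b -> is_derive T x (/ g x)) ->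
  forall y, exists x, p <= x < b /\ y < T x.
Proof.
  intros Hpb HC Hg HT y.
  (* [m] exceeds [y - T p] and is positive, so that [x] below lies to the right of [p]. That [x]
     solves [ln (b - x) = ln (b - p) - C * m], which makes [T x >= T p + m > y]. *)
  set (m := Rmax (y - T p) 0 + 1).
  pose proof (Rmax_l (y - T p) 0); pose proof (Rmax_r (y - T p) 0).
  set (x := b - (b - p) * exp (- (C * m))).
  assert (HCm : 0 < C * m) by (apply Rmult_lt_0_compat; unfold m; lra).
  assert (He : 0 < exp (- (C * m)) < 1).
  { split; [apply exp_pos | rewrite <- exp_0; apply exp_increasing; lra]. }
  assert (Hx : p <= x < b).
  { unfold x; split; nra. }
  exists x; split; [exact Hx |].
  assert (Hmono : T p + ln (b - p) / C <= T x + ln (b - x) / C).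
  { apply (nondecreasing_of_derive_nonneg (fun z => T z + ln (b - z) / C)
             (fun z => / g z - / (C * (b - z)))); [lra | |]; intros z Hz;
      assert (Hgz : 0 < g z <= C * (b - z)) by (apply Hg; lra).
    - replace (/ g z - / (C * (b - z)))
        with (/ g z + (- / (b - z)) * / C) by (field; lra).
      apply @is_derive_plus; [apply HT; lra |].
      auto_derive; [lra | field; lra].
    - pose proof (Rinv_le_contravar (g z) (C * (b - z)) ltac:(lra) ltac:(lra)); lra. }
  replace (b - x) with ((b - p) * exp (- (C * m))) in Hmono by (unfold x; ring).
  rewrite ln_mult, ln_exp in Hmono by lra.
  replace ((ln (b - p) + - (C * m)) / C) with (ln (b - p) / C - m) in Hmono
    by (field; lra).
  assert (y - T p < m) by (unfold m; lra); lra.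
Qed.

(** The reflection [x -> - x] exchanges the two ends, and [- T (- x)] is a primitive of
    [1 / g (- x)]. *)
Lemma unbounded_below_at_finite_end (a p C : R) (g T : R -> R) :
  a < p -> 0 < C ->
  (forall x, a < x <= p -> 0 < g x <= C * (x - a)) ->
  (forall x, a < x <= p -> is_derive T x (/ g x)) ->
  forall y, exists x, a < x <= p /\ T x < y.
Proof.
  intros Hap HC Hg HT y.
  destruct (unbounded_above_at_finite_end (- p) (- a) C (fun x => g (- x))
              (fun x => - T (- x))) with (y := - y) as [x [Hx Hy]].
  - lra.
  - exact HC.
  - intros x Hx; replace (- a - x) with (- x - a) by ring; apply Hg; lra.
  - intros x Hx.
    replace (/ g (- x)) with (- (-1 * / g (- x))) by ring.
    apply @is_derive_opp, (is_derive_comp T Ropp); [apply HT; lra |].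
    auto_derive; [exact I | ring].
  - exists (- x); split; lra.
Qed.

(** [T x - x / C] is nondecreasing, so [T] grows at least linearly. *)
Lemma unbounded_above_at_infinity (p C : R) (g T : R -> R) :
  0 < C -> (forall x, p <= x -> 0 < g x <= C) ->
  (forall x, p <= x -> is_derive T x (/ g x)) ->
  forall y, exists x, p <= x /\ y < T x.
Proof.
  intros HC Hg HT y.
  set (m := Rmax (y - T p) 0 + 1).
  pose proof (Rmax_l (y - T p) 0); pose proof (Rmax_r (y - T p) 0).
  assert (HCm : 0 < C * m) by (apply Rmult_lt_0_compat; unfold m; lra).
  exists (p + C * m); split; [lra |].
  assert (Hmono : T p - p / C <= T (p + C * m) - (p + C * m) / C).
  { apply (nondecreasing_of_derive_nonneg (fun z => T z - z / C)
             (fun z => / g z - / C)); [lra | |]; intros z Hz;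
      assert (Hgz : 0 < g z <= C) by (apply Hg; lra).
    - apply @is_derive_minus; [apply HT; lra |].
      auto_derive; [exact I | field; lra].
    - pose proof (Rinv_le_contravar (g z) C ltac:(lra) ltac:(lra)); lra. }
  replace ((p + C * m) / C) with (p / C + m) in Hmono by (field; lra).
  assert (y - T p < m) by (unfold m; lra); lra.
Qed.

(* [T x] is the time at which the solution [r] of r' = g(r) reaches the radius
   [x]. *)
Definition flow_through (a b : Rbar) (g T r : R -> R) : Prop :=
  (forall x, open_interval a b x ->
     0 < g x /\ is_derive T x (/ g x) /\ r (T x) = x) /\
  (forall t, open_interval a b (r t) /\ T (r t) = t /\ is_derive r t (g (r t))).

(** The inverse function theorem, in the form in which [T' = 1 / g] turns into [r' = g(r)]. [T] is
    strictly increasing, which makes [r] a two-sided inverse and continuous. *)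
Lemma inverse_of_primitive_flow (a b : Rbar) (g T r : R -> R) :
  (forall x, open_interval a b x -> 0 < g x) ->
  (forall x, open_interval a b x -> continuous g x) ->
  (forall x, open_interval a b x -> is_derive T x (/ g x)) ->
  (forall t, open_interval a b (r t) /\ T (r t) = t) ->
  flow_through a b g T r.
Proof.
  intros Hpos Hg HT Hr.
  assert (Hinc : forall x y, open_interval a b x -> open_interval a b y ->
            x < y -> T x < T y).
  { intros x y [Hx _] [_ Hy] Hxy.
    apply (incr_function T a b (fun x => / g x)); try assumption.
    - intros z Hz1 Hz2; apply HT; split; assumption.
    - intros z Hz1 Hz2; apply Rinv_0_lt_compat, Hpos; split; assumption. }
  assert (Hinc' : forall x y, open_interval a b x -> open_interval a b y ->
            T x < T y -> x < y).
  { intros x y Hx Hy Hxy; apply Rnot_le_lt; intros [Hyx | ->]; [| lra].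
    specialize (Hinc y x Hy Hx Hyx); lra. }
  assert (Hcont : forall t, continuous r t).
  { intros t; apply filterlim_locally; intros e.
    destruct (Hr t) as [Ht Htt].
    destruct (open_interval_neighbourhood a b (r t) Ht) as [d Hd].
    pose proof (cond_pos e); pose proof (cond_pos d).
    (* Half of the minimum keeps [r t - k] and [r t + k] inside the interval. Their images under [T]
       enclose [t], and for [s] between these images monotonicity traps [r s]. *)
    set (k := Rmin e d / 2).
    assert (Hk : 0 < k /\ k < e /\ k < d).
    { pose proof (Rmin_l e d); pose proof (Rmin_r e d).
      pose proof (Rmin_glb_lt e d 0 ltac:(lra) ltac:(lra)); unfold k; lra. }
    assert (Hl : open_interval a b (r t - k))
      by (apply Hd; rewrite Rabs_left; lra).
    assert (Hu : open_interval a b (r t + k))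
      by (apply Hd; rewrite Rabs_right; lra).
    assert (Hlt : T (r t - k) < t)
      by (rewrite <- Htt at 2; apply Hinc; auto; lra).
    assert (Hut : t < T (r t + k))
      by (rewrite <- Htt at 1; apply Hinc; auto; lra).
    apply (filter_imp (fun s => T (r t - k) < s /\ s < T (r t + k))).
    - intros s [Hs1 Hs2]; destruct (Hr s) as [Hs Hss].
      rewrite <- Hss in Hs1, Hs2.
      apply Hinc' in Hs1; auto; apply Hinc' in Hs2; auto.
      apply Rabs_def1; simpl; unfold minus, plus, opp; simpl; lra.
    - apply filter_and; [exact (open_gt _ t Hlt) | exact (open_lt _ t Hut)]. }
  split.
  - intros x Hx; split; [auto | split; [auto |]].
    destruct (Hr (T x)) as [Hrx HTx].
    destruct (Rtotal_order (r (T x)) x) as [H | [H | H]]; [| exact H |].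
    + specialize (Hinc (r (T x)) x Hrx Hx H); lra.
    + specialize (Hinc x (r (T x)) Hx Hrx H); lra.
  - intros t; destruct (Hr t) as [Ht Htt].
    split; [exact Ht | split; [exact Htt |]].
    apply is_derive_Reals; intros e He.
    destruct (continuous_epsilon g (r t) e (Hg _ Ht) He) as [d [Hd Hgd]].
    destruct (continuous_epsilon r t d (Hcont t) Hd) as [d' [Hd' Hrd]].
    exists (mkposreal d' Hd'); simpl; intros h Hh0 Hh.
    destruct (Hr (t + h)) as [Hth Hthh].
    (* As [T (r t) = t], this reads [h = (r (t + h) - r t) / g c]: the difference quotient is
       exactly [g c], with [c] squeezed towards [r t]. *)
    destruct (mean_value T (fun x => / g x) (r t) (r (t + h)))
      as [c [Hc Heq]].
    + intros x Hx; apply HT.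
      exact (open_interval_convex_minmax a b _ _ x Ht Hth Hx).
    + rewrite Htt, Hthh in Heq.
      assert (Hgc : 0 < g c)
        by exact (Hpos c (open_interval_convex_minmax a b _ _ c Ht Hth Hc)).
      replace ((r (t + h) - r t) / h) with (g c).
      * apply Hgd.
        assert (Hrh : Rabs (r (t + h) - r t) < d)
          by (apply Hrd; replace (t + h - t) with h by ring; exact Hh).
        apply Rabs_def2 in Hrh; apply Rabs_def1.
        { revert Hc; unfold Rmin, Rmax; destruct (Rle_dec (r t) (r (t + h)));
            lra. }
        { revert Hc; unfold Rmin, Rmax; destruct (Rle_dec (r t) (r (t + h)));
            lra. }
      * replace h with (/ g c * (r (t + h) - r t)) at 2 by lra.
        assert (r (t + h) - r t <> 0).
        { intros H0; rewrite H0 in Heq; lra. }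
        field; split; lra.
Qed.

(** Unboundedness in both directions makes [T] onto the real line, hence [r] global. It is asked of
    every primitive, because the one in use is only produced inside the proof. *)
Lemma flow_exists (a b : Rbar) (g : R -> R) (c : R) :
  open_interval a b c ->
  (forall x, open_interval a b x -> 0 < g x) ->
  (forall x, open_interval a b x -> continuous g x) ->
  (forall T, (forall x, open_interval a b x -> is_derive T x (/ g x)) ->
     forall y, (exists x, open_interval a b x /\ T x < y) /\
               (exists x, open_interval a b x /\ y < T x)) ->
  exists T r, flow_through a b g T r.
Proof.
  intros Hc Hpos Hg Hunb.
  destruct (primitive_exists a b (fun x => / g x) c Hc) as [T HT].
  { intros x Hx; apply (continuous_comp g Rinv); [auto |].
    apply continuous_Rinv; specialize (Hpos x Hx); lra. }
  assert (Hsurj : forall t, exists x, open_interval a b x /\ T x = t).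
  { intros t; destruct (Hunb T HT t) as [[x [Hx Hxt]] [y [Hy Hyt]]].
    assert (Hlt : x < y).
    { apply Rnot_le_lt; intros Hle.
      assert (T y <= T x); [| lra].
      apply (nondecreasing_of_derive_nonneg T (fun x => / g x) y x Hle);
        intros w Hw; pose proof (open_interval_convex a b y x w Hy Hx Hw).
      - now apply HT.
      - now apply Rlt_le, Rinv_0_lt_compat, Hpos. }
    destruct (Ranalysis5.IVT_interv (fun x => T x - t) x y) as [w [Hw Hwt]];
      try lra.
    - intros w Hw; apply continuity_pt_minus.
      + apply is_derive_continuity_pt with (/ g w), HT.
        exact (open_interval_convex a b x y w Hx Hy Hw).
      + apply continuity_pt_const; intros ? ?; reflexivity.
    - exists w; split; [exact (open_interval_convex a b x y w Hx Hy Hw) | lra]. }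
  exists T, (fun t => proj1_sig (constructive_indefinite_description _ (Hsurj t))).
  apply inverse_of_primitive_flow; auto.
  intros t; exact (proj2_sig (constructive_indefinite_description _ (Hsurj t))).
Qed.

(** * Uniqueness at a double zero of the right-hand side *)

(** The derivative [2 u u'] of [u ^ 2] is at most [2 C u ^ 2] in absolute value. So
    [u ^ 2 * exp (- 2 * C * x)] is nonincreasing, which settles [s <= t], and
    [u ^ 2 * exp (2 * C * x)] is nondecreasing, which settles [t < s]. *)
Lemma gronwall_zero (u du : R -> R) (s t C : R) :
  (forall x, Rmin s t <= x <= Rmax s t ->
     is_derive u x (du x) /\ Rabs (du x) <= C * Rabs (u x)) ->
  u s = 0 -> u t = 0.
Proof.
  intros Hu Hs.
  assert (Hprod : forall x, Rmin s t <= x <= Rmax s t ->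
            - (C * u x ^ 2) <= u x * du x <= C * u x ^ 2).
  { intros x Hx; destruct (Hu x Hx) as [_ Hdu].
    assert (H : Rabs (u x * du x) <= C * u x ^ 2).
    { rewrite Rabs_mult, <- pow2_abs.
      pose proof (Rmult_le_compat_l _ _ _ (Rabs_pos (u x)) Hdu); lra. }
    revert H; unfold Rabs; destruct (Rcase_abs (u x * du x)); lra. }
  assert (Hsq : u t ^ 2 <= 0).
  { destruct (Rle_dec s t) as [Hst | Hst].
    - rewrite Rmin_left, Rmax_right in * by lra.
      assert (H : - (u s ^ 2 * exp (- 2 * C * s))
                  <= - (u t ^ 2 * exp (- 2 * C * t))).
      { apply (nondecreasing_of_derive_nonneg
                 (fun x => - (u x ^ 2 * exp (- 2 * C * x)))
                 (fun x => 2 * (C * u x ^ 2 - u x * du x)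
                           * exp (- 2 * C * x)));
          [lra | |]; intros x Hx.
        - destruct (Hu x Hx) as [Hdu _].
          auto_derive; [now exists (du x) |].
          replace (Derive _ x) with (du x)
            by (symmetry; exact (is_derive_unique _ _ _ Hdu)); ring.
        - specialize (Hprod x Hx).
          apply Rmult_le_pos; [lra | apply Rlt_le, exp_pos]. }
      rewrite Hs in H; pose proof (exp_pos (- 2 * C * t)); nra.
    - rewrite Rmin_right, Rmax_left in * by lra.
      assert (H : u t ^ 2 * exp (2 * C * t) <= u s ^ 2 * exp (2 * C * s)).
      { apply (nondecreasing_of_derive_nonneg
                 (fun x => u x ^ 2 * exp (2 * C * x))
                 (fun x => 2 * (C * u x ^ 2 + u x * du x)
                           * exp (2 * C * x)));
          [lra | |]; intros x Hx.
        - destruct (Hu x Hx) as [Hdu _].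
          auto_derive; [now exists (du x) |].
          replace (Derive _ x) with (du x)
            by (symmetry; exact (is_derive_unique _ _ _ Hdu)); ring.
        - specialize (Hprod x Hx).
          apply Rmult_le_pos; [lra | apply Rlt_le, exp_pos]. }
      rewrite Hs in H; pose proof (exp_pos (2 * C * t)); nra. }
  nra.
Qed.

(* Near [z] the ODE gives |q'| <= C |q - z|; away from [z], on a compact time
   interval, |q'| is bounded and |q - z| is bounded below. *)
Lemma solution_constant_at_double_zero (a b : Rbar) (G q : R -> R)
  (z d K s t : R) :
  0 < d -> 0 <= K ->
  (forall x, Rabs (x - z) < d -> G x <= K * (x - z) ^ 2) ->
  (forall x, open_interval a b x ->
     ex_derive q x /\ continuous (Derive q) x /\ Derive q x ^ 2 = G (q x)) ->
  open_interval a b s -> open_interval a b t -> q s = z -> q t = z.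
Proof.
  intros Hd HK HG Hq Hs Ht Hqs.
  assert (Hsub : forall x, Rmin s t <= x <= Rmax s t -> open_interval a b x)
    by (intros x Hx; exact (open_interval_convex_minmax a b s t x Hs Ht Hx)).
  destruct (continuity_ab_maj (fun x => Rabs (Derive q x)) (Rmin s t) (Rmax s t))
    as [y [Hy _]].
  { pose proof (Rmin_l s t); pose proof (Rmax_l s t); lra. }
  { intros x Hx; apply continuity_pt_filterlim.
    apply (continuous_comp (Derive q) Rabs); [apply Hq, Hsub, Hx |].
    apply continuous_Rabs. }
  set (L := Rabs (Derive q y)).
  assert (HL : 0 <= L) by apply Rabs_pos.
  assert (HLd : 0 <= L / d).
  { unfold Rdiv; apply Rmult_le_pos; [lra |].
    apply Rlt_le, Rinv_0_lt_compat, Hd. }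
  assert (H0 : q t - z = 0); [| lra].
  apply (gronwall_zero (fun x => q x - z) (Derive q) s t (K + 1 + L / d));
    [| lra].
  intros x Hx; destruct (Hq x (Hsub x Hx)) as [Hqx [_ Hode]]; split.
  - replace (Derive q x) with (Derive q x - 0) by ring.
    apply @is_derive_minus; [now apply Derive_correct | apply @is_derive_const].
  - pose proof (Rabs_pos (q x - z)) as Hpos.
    destruct (Rlt_dec (Rabs (q x - z)) d) as [Hlt | Hge].
    (* The squared derivative is at most [K * (q x - z) ^ 2], and [K + 1] stands in for [sqrt K]
       since [K <= (K + 1) ^ 2]. *)
    + apply Rle_trans with ((K + 1) * Rabs (q x - z)); [| nra].
      rewrite <- (Rabs_right (K + 1)), <- Rabs_mult by lra.
      apply Rsqr_le_abs_0; unfold Rsqr.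
      specialize (HG (q x) Hlt); rewrite <- Hode in HG.
      pose proof (pow2_ge_0 (q x - z)); nra.
    + apply Rle_trans with L; [exact (Hy x Hx) |].
      apply Rle_trans with (L / d * Rabs (q x - z)); [| nra].
      replace L with (L / d * d) at 1 by (field; lra).
      apply Rmult_le_compat_l; lra.
Qed.

(** A zero of a nonnegative function is a minimum, so [G' z = 0]. Then [G'] is of order [x - z] by
    its derivative at [z], and the mean value theorem makes [G] of order [(x - z) ^ 2]. *)
Lemma quadratic_bound_at_zero_minimum (D : R -> Prop) (G : R -> R) (z : R) :
  open D -> differentiable_upto 2 D G -> (forall x, D x -> 0 <= G x) ->
  D z -> G z = 0 ->
  exists d K, 0 < d /\ 0 <= K /\
    forall x, Rabs (x - z) < d -> D x /\ G x <= K * (x - z) ^ 2.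
Proof.
  intros HD [G' [HG [G'' [HG' _]]]] Hpos Hz HGz.
  destruct (HD z Hz) as [d1 Hd1].
  pose proof (cond_pos d1) as Hd1pos.
  assert (HD1 : forall x, Rabs (x - z) < d1 -> D x) by exact Hd1.
  assert (Hcrit : G' z = 0).
  { pose proof (proj1 (is_derive_Reals G z (G' z)) (HG z Hz)) as Hl.
    (* Built by hand so that [derive_pt G z pr] is [G' z] by conversion. *)
    pose (pr := exist (fun l => derivable_pt_abs G z l) (G' z) Hl).
    change (derive_pt G z pr = 0).
    apply (deriv_minimum G (z - d1) (z + d1)); try lra.
    intros x Hx1 Hx2; rewrite HGz; apply Hpos, HD1, Rabs_def1; lra. }
  (* The tolerance 1 in the limit of [G' c / (c - z)] is the [+ 1] in the constant below. *)
  destruct (proj1 (is_derive_Reals G' z _) (HG' z Hz) 1 Rlt_0_1) as [d2 Hd2].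
  pose proof (cond_pos d2) as Hd2pos.
  exists (Rmin d1 d2), (Rabs (G'' z) + 1).
  pose proof (Rabs_pos (G'' z)) as HK.
  split; [apply Rmin_glb_lt; lra | split; [lra |]]; intros x Hx.
  pose proof (Rmin_l d1 d2); pose proof (Rmin_r d1 d2).
  split; [apply HD1; lra |].
  assert (Hbetween : forall c, Rmin z x <= c <= Rmax z x ->
            Rabs (c - z) <= Rabs (x - z)).
  { intros c; unfold Rmin, Rmax, Rabs; destruct (Rle_dec z x);
      destruct (Rcase_abs (c - z)); destruct (Rcase_abs (x - z)); lra. }
  destruct (mean_value G G' z x) as [c [Hc Heq]].
  { intros c Hc; apply HG, HD1; specialize (Hbetween c Hc); lra. }
  specialize (Hbetween c Hc).
  assert (HG'c : Rabs (G' c) <= (Rabs (G'' z) + 1) * Rabs (x - z)).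
  { apply Rle_trans with ((Rabs (G'' z) + 1) * Rabs (c - z)); [| nra].
    destruct (Req_dec c z) as [-> | Hcz].
    - rewrite Hcrit, Rabs_R0; apply Rmult_le_pos; [lra | apply Rabs_pos].
    - specialize (Hd2 (c - z) ltac:(lra) ltac:(lra)).
      replace (z + (c - z)) with c in Hd2 by ring.
      rewrite Hcrit, Rminus_0_r in Hd2.
      replace (G' c) with (G' c / (c - z) * (c - z)) at 1 by (field; lra).
      rewrite Rabs_mult; apply Rmult_le_compat_r; [apply Rabs_pos |].
      pose proof (Rabs_triang (G' c / (c - z) - G'' z) (G'' z)) as Htri.
      replace (G' c / (c - z) - G'' z + G'' z) with (G' c / (c - z)) in Htri
        by ring.
      lra. }
  rewrite HGz, Rminus_0_r in Heq; rewrite Heq.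
  apply Rle_trans with (Rabs (G' c * (x - z))); [apply Rle_abs |].
  rewrite Rabs_mult, <- pow2_abs.
  pose proof (Rabs_pos (x - z)); nra.
Qed.

(** * Flows as solutions of the photon surface equation *)

Lemma strict_increasing_limits (s : R -> R) (a : R) (b : Rbar) :
  strict_increasing s -> has_range s a b ->
  is_lim s m_infty a /\ is_lim s p_infty b.
Proof.
  intros Hs Hr.
  destruct (proj1 (Hr (s 0)) (ex_intro _ 0 eq_refl)) as [Ha Hb].
  simpl in Ha.
  assert (Hin : forall t, Rbar_lt a (s t) /\ Rbar_lt (s t) b)
    by (intros t; apply Hr; now exists t).
  split; apply is_lim_spec; [| destruct b as [b | |]].
  - intros e; pose proof (cond_pos e).
    (* The minimum with [s 0] keeps the prescribed value below [b], hence in the range. *)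
    destruct (proj2 (Hr (Rmin (s 0) (a + e / 2)))) as [t0 Ht0].
    { pose proof (Rmin_l (s 0) (a + e / 2)).
      split; [apply Rmin_glb_lt; lra |].
      now apply Rbar_le_lt_trans with (s 0). }
    exists t0; intros t Ht; specialize (Hs t t0 Ht).
    pose proof (Rmin_r (s 0) (a + e / 2)); destruct (Hin t) as [Hat _].
    simpl in Hat; apply Rabs_def1; lra.
  - intros e; pose proof (cond_pos e); simpl in Hb.
    destruct (proj2 (Hr (Rmax (s 0) (b - e / 2)))) as [t0 Ht0].
    { pose proof (Rmax_l (s 0) (b - e / 2)).
      split; [simpl; lra | apply Rmax_lub_lt; lra]. }
    exists t0; intros t Ht; specialize (Hs t0 t Ht).
    pose proof (Rmax_r (s 0) (b - e / 2)); destruct (Hin t) as [_ Hbt].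
    simpl in Hbt; apply Rabs_def1; lra.
  - intros N.
    destruct (proj2 (Hr (Rmax (s 0) N))) as [t0 Ht0].
    { pose proof (Rmax_l (s 0) N); split; [simpl; lra | exact I]. }
    exists t0; intros t Ht; specialize (Hs t0 t Ht).
    pose proof (Rmax_r (s 0) N); lra.
  - destruct Hb.
Qed.

Lemma flow_strict_increasing (a b : Rbar) (g T r : R -> R) :
  flow_through a b g T r -> strict_increasing r.
Proof.
  intros [HT Hr] s t Hst.
  apply (incr_function r m_infty p_infty (fun x => g (r x))); try exact I;
    try exact Hst.
  - intros x _ _; apply Hr.
  - intros x _ _; apply HT, Hr.
Qed.

(** The [G] of the overview, at a given [lambda]. Up to conversion [photon_surface_ODE] is
    [Derive r t ^ 2 = ode_rhs M lambda (r t)], on which the [change] steps rely. *)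
Definition ode_rhs (M : spacetime) (lambda x : R) : R :=
  (metric_coef M x) ^ 2 * (lambda ^ 2 * x ^ 2 - metric_coef M x)
  / (lambda ^ 2 * x ^ 2).

(** The squared equation does not see the sign of [r']; [e = 1] and [e = -1] cover the
    time-translations of [r] and of its reflection at once. *)
Lemma flow_smooth_global_solution (M : spacetime) (lambda : R) (a b : Rbar)
  (T r s : R -> R) (c e : R) :
  (forall x, open_interval a b x -> radii M x) ->
  (forall k, differentiable_upto k (open_interval a b)
               (fun x => sqrt (ode_rhs M lambda x))) ->
  flow_through a b (fun x => sqrt (ode_rhs M lambda x)) T r ->
  e ^ 2 = 1 -> (forall t, s t = r (c + e * t)) ->
  smooth_global_solution M lambda s.
Proof.
  intros Hrad Hsmooth [HT Hr] He Hs.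
  replace s with (fun t => r (c + e * t))
    by (apply functional_extensionality; intros t; now rewrite Hs).
  clear s Hs; split.
  - apply differentiable_upto_smooth_on; [apply open_true |]; intros k.
    apply (differentiable_upto_comp k (fun _ => True)); [easy | |].
    + apply differentiable_upto_autonomous with
        (open_interval a b) (fun x => sqrt (ode_rhs M lambda x)); [exact Hsmooth |].
      intros t _; split; apply Hr.
    + apply differentiable_upto_plus; [apply differentiable_upto_const |].
      apply differentiable_upto_mult;
        [apply differentiable_upto_const | apply differentiable_upto_id].
  - intros t; destruct (Hr (c + e * t)) as [Hin [_ Hder]].
    split; [now apply Hrad |].
    change (Derive (fun t => r (c + e * t)) t ^ 2
            = ode_rhs M lambda (r (c + e * t))).
    assert (Hpos : 0 < sqrt (ode_rhs M lambda (r (c + e * t)))) by now apply HT.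
    assert (Hd : Derive (fun t => r (c + e * t)) t
                 = e * sqrt (ode_rhs M lambda (r (c + e * t)))).
    { apply is_derive_unique.
      apply (is_derive_comp r (fun t => c + e * t)); [exact Hder |].
      auto_derive; [exact I | ring]. }
    rewrite Hd, Rpow_mult_distr, He, Rmult_1_l.
    (* [sqrt] is 0 on negative numbers, so its positivity at this point excludes a negative
       [ode_rhs]. *)
    apply pow2_sqrt, Rnot_lt_le; intros Hneg.
    rewrite sqrt_neg_0 in Hpos; lra.
Qed.

(** [T (q t)] measures elapsed time: its derivative, [q'] over the square root, has modulus 1, and
    the sign cannot change because [q'] is continuous and never 0. So [T (q t)] is affine of slope 1
    or -1, and applying [r] gives back [q]. *)
Lemma local_solution_of_flow (M : spacetime) (lambda : R) (a b a' b' : Rbar)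
  (T r q : R -> R) (t0 : R) :
  flow_through a b (fun x => sqrt (ode_rhs M lambda x)) T r ->
  open_interval a' b' t0 -> local_C1_solution M lambda a' b' q ->
  (forall t, open_interval a' b' t -> open_interval a b (q t)) ->
  (forall t, open_interval a' b' t -> q t = r (T (q t0) + (t - t0))) \/
  (forall t, open_interval a' b' t -> q t = r (T (q t0) - (t - t0))).
Proof.
  intros [HT Hr] Ht0 Hq Hin.
  assert (Hsqrt : forall t, open_interval a' b' t ->
            0 < sqrt (ode_rhs M lambda (q t)) /\
            Derive q t ^ 2 = sqrt (ode_rhs M lambda (q t)) ^ 2).
  { intros t Ht; destruct (Hq t Ht) as [_ [_ [_ Hode]]].
    change (Derive q t ^ 2 = ode_rhs M lambda (q t)) in Hode.
    split; [now apply HT, Hin |].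
    rewrite Hode, pow2_sqrt; [reflexivity |].
    rewrite <- Hode; apply pow2_ge_0. }
  assert (Hn : forall t, open_interval a' b' t -> Derive q t <> 0).
  { intros t Ht H0; destruct (Hsqrt t Ht) as [Hpos Hsq].
    rewrite H0 in Hsq; nra. }
  assert (Hsolve : forall e, (forall t, open_interval a' b' t ->
            Derive q t = e * sqrt (ode_rhs M lambda (q t))) ->
            forall t, open_interval a' b' t -> q t = r (T (q t0) + e * (t - t0))).
  { intros e He t Ht.
    destruct (mean_value (fun x => T (q x)) (fun _ => e) t0 t) as [c [_ Heq]].
    - intros x Hx.
      assert (Hxin := open_interval_convex_minmax a' b' t0 t x Ht0 Ht Hx).
      destruct (HT (q x) (Hin x Hxin)) as [Hpos [HTx _]].
      replace e with (Derive q x * / sqrt (ode_rhs M lambda (q x)))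
        by (rewrite (He x Hxin); field; lra).
      apply (is_derive_comp T q); [exact HTx |].
      apply Derive_correct, Hq, Hxin.
    - replace (T (q t0) + e * (t - t0)) with (T (q t)) by lra.
      symmetry; now apply HT, Hin. }
  destruct (Rtotal_order (Derive q t0) 0) as [Hlt | [H0 | Hgt]];
    [right | now destruct (Hn t0 Ht0) | left]; intros t Ht.
  - replace (T (q t0) - (t - t0)) with (T (q t0) + -1 * (t - t0)) by ring.
    revert t Ht; apply Hsolve; intros t Ht.
    assert (Hneg : 0 < - Derive q t).
    { apply (nonvanishing_same_sign a' b' (fun x => - Derive q x) t0 t);
        auto; try lra.
      - intros x Hx; apply (continuous_opp (Derive q)); now apply Hq.
      - intros x Hx H; apply (Hn x Hx); lra. }
    destruct (Hsqrt t Ht); nra.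
  - replace (t - t0) with (1 * (t - t0)) by ring.
    revert t Ht; apply Hsolve; intros t Ht.
    assert (Hpos : 0 < Derive q t).
    { apply (nonvanishing_same_sign a' b' (Derive q) t0 t); auto.
      intros x Hx; now apply Hq. }
    destruct (Hsqrt t Ht); nra.
Qed.

(** The third hypothesis confines solutions that start in the interval; this is where the double
    zero at [r_star] will enter. The two candidates differ at every [t <> t0] because [r] is
    injective. *)
Lemma flow_precisely_two_solutions (M : spacetime) (lambda : R) (a b : Rbar)
  (T r : R -> R) (t0 r0 : R) :
  (forall x, open_interval a b x -> radii M x) ->
  (forall k, differentiable_upto k (open_interval a b)
               (fun x => sqrt (ode_rhs M lambda x))) ->
  (forall a' b' q s t, local_C1_solution M lambda a' b' q ->
     open_interval a' b' s -> open_interval a' b' t ->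
     open_interval a b (q s) -> open_interval a b (q t)) ->
  flow_through a b (fun x => sqrt (ode_rhs M lambda x)) T r ->
  open_interval a b r0 ->
  precisely_two_solutions M lambda t0 r0
    (fun t => r (T r0 + (t - t0))) (fun t => r (T r0 - (t - t0))).
Proof.
  intros Hrad Hsmooth Hconf Hflow Hr0.
  assert (HrT : r (T r0) = r0) by now apply Hflow.
  pose proof (flow_strict_increasing _ _ _ _ _ Hflow) as Hinc.
  split; [| split; [| split; [| split; [| split]]]].
  - apply (flow_smooth_global_solution M lambda a b T r _ (T r0 - t0) 1 Hrad
             Hsmooth Hflow); [ring |].
    intros t; f_equal; ring.
  - rewrite <- HrT at 2; f_equal; ring.
  - apply (flow_smooth_global_solution M lambda a b T r _ (T r0 + t0) (-1) Hrad
             Hsmooth Hflow); [ring |].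
    intros t; f_equal; ring.
  - rewrite <- HrT at 2; f_equal; ring.
  - intros a' b' Ht0.
    destruct (open_interval_exists_right a' b' t0 Ht0) as [t [Hlt Ht]].
    exists t; split; [exact Ht |].
    apply Rgt_not_eq, Hinc; lra.
  - intros a' b' q Ht0 Hq <-.
    apply (local_solution_of_flow M lambda a b); auto.
    intros t Ht; exact (Hconf a' b' q t0 t Hq Ht0 Ht Hr0).
Qed.

(** One statement for both sides of [r_star]: the inner side has a finite upper end, the outer one
    [p_infty], whence the types of [a] and [b]. *)
Lemma flow_solutions (M : spacetime) (lambda a : R) (b : Rbar) (T r : R -> R) :
  (forall x, open_interval a b x -> radii M x) ->
  (forall k, differentiable_upto k (open_interval a b)
               (fun x => sqrt (ode_rhs M lambda x))) ->
  (forall a' b' q s t, local_C1_solution M lambda a' b' q ->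
     open_interval a' b' s -> open_interval a' b' t ->
     open_interval a b (q s) -> open_interval a b (q t)) ->
  flow_through a b (fun x => sqrt (ode_rhs M lambda x)) T r ->
  (smooth_global_solution M lambda r /\ strict_increasing r /\
   has_range r a b) /\
  (forall r0, open_interval a b r0 ->
     exists rp rm : R -> R,
       precisely_two_solutions M lambda 0 r0 rp rm /\
       is_time_reflection rm rp /\
       is_time_translation rp r /\
       (strict_increasing rp /\ is_lim rp m_infty a /\ is_lim rp p_infty b) /\
       (strict_decreasing rm /\ is_lim rm m_infty b /\ is_lim rm p_infty a) /\
       (forall t0 : R,
          precisely_two_solutions M lambda t0 r0
            (time_translate (- t0) rp) (time_translate (- t0) rm))).
Proof.
  intros Hrad Hsmooth Hconf Hflow.
  pose proof (flow_strict_increasing _ _ _ _ _ Hflow) as Hinc.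
  assert (Hrange : has_range r a b).
  { intros y; split.
    - intros [t <-]; apply Hflow.
    - intros Hy; exists (T y); now apply Hflow. }
  split; [split; [| split; assumption] |].
  - apply (flow_smooth_global_solution M lambda a b T r r 0 1 Hrad Hsmooth
             Hflow); [ring |].
    intros t; f_equal; ring.
  - intros r0 Hr0.
    pose proof (flow_precisely_two_solutions M lambda a b T r) as Htwo.
    exists (fun t => r (T r0 + t)), (fun t => r (T r0 - t)).
    assert (Hinc0 : strict_increasing (fun t => r (T r0 + t)))
      by (intros s t Hst; apply Hinc; lra).
    assert (Hrange0 : has_range (fun t => r (T r0 + t)) a b).
    { intros y; split.
      - intros [t <-]; apply Hflow.
      - intros Hy; exists (T y - T r0).
        replace (T r0 + (T y - T r0)) with (T y) by ring; now apply Hflow. }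
    destruct (strict_increasing_limits _ _ _ Hinc0 Hrange0) as [Hlim Hlim'].
    split; [| split; [| split; [| split; [| split]]]].
    + replace (fun t => r (T r0 + t)) with (fun t => r (T r0 + (t - 0)))
        by (apply functional_extensionality; intros t; f_equal; ring).
      replace (fun t => r (T r0 - t)) with (fun t => r (T r0 - (t - 0)))
        by (apply functional_extensionality; intros t; f_equal; ring).
      now apply Htwo.
    + intros t; reflexivity.
    + exists (T r0); intros t; unfold time_translate; f_equal; ring.
    + auto.
    + split; [intros s t Hst; apply Hinc; lra |].
      split.
      * exact (filterlim_comp _ _ _ Ropp (fun t => r (T r0 + t)) _ _ _
                 (filterlim_Rbar_opp m_infty) Hlim').
      * exact (filterlim_comp _ _ _ Ropp (fun t => r (T r0 + t)) _ _ _
                 (filterlim_Rbar_opp p_infty) Hlim).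
    (* [time_translate (- t0)] produces [t + - t0], which is convertible to [t - t0]. *)
    + intros t0; now apply Htwo.
Qed.

(** * The horizon estimate and the two sides of the photon sphere *)

(** Meant for the extension of [f] to the horizon, where only a derivative from the right is given:
    tolerance 1 in the limit of the difference quotient yields [C]. *)
Lemma linear_bound_right_of_zero (F F' : R -> R) (a : R) :
  D_in F F' (fun r => a <= r) a -> F a = 0 ->
  exists d C, 0 < d /\ 0 < C /\ forall x, a < x < a + d -> F x <= C * (x - a).
Proof.
  intros HF HFa.
  destruct (HF 1 Rlt_0_1) as [d [Hd HFd]].
  exists d, (Rabs (F' a) + 1); pose proof (Rabs_pos (F' a)).
  split; [exact Hd | split; [lra |]]; intros x Hx.
  specialize (HFd x); simpl in HFd; unfold Rdist, D_x in HFd.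
  assert (Hq : Rabs ((F x - F a) / (x - a) - F' a) < 1).
  { apply HFd; split; [lra | rewrite Rabs_right; lra]. }
  rewrite HFa, Rminus_0_r in Hq; apply Rabs_def2 in Hq.
  pose proof (Rle_abs (F' a)).
  replace (F x) with (F x / (x - a) * (x - a)) by (field; lra).
  apply Rmult_le_compat_r; lra.
Qed.

Theorem theorem3p9 (M : spacetime) (r_H r_star lambda : R)
  (hM : class_S_ext M r_H r_star) (hlambda : lambda ^ 2 = v M r_star) :
  (forall t0 : R, unique_solution M lambda t0 r_star (fun _ => r_star)) /\
  exists rp_star Rp_star : R -> R,
    (smooth_global_solution M lambda rp_star /\
     strict_increasing rp_star /\ has_range rp_star r_H r_star) /\
    (smooth_global_solution M lambda Rp_star /\
     strict_increasing Rp_star /\ has_range Rp_star r_star p_infty) /\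
    (forall r0 : R, r_H < r0 < r_star ->
       exists rp rm : R -> R,
         precisely_two_solutions M lambda 0 r0 rp rm /\
         is_time_reflection rm rp /\
         is_time_translation rp rp_star /\
         (strict_increasing rp /\
          is_lim rp m_infty r_H /\ is_lim rp p_infty r_star) /\
         (strict_decreasing rm /\
          is_lim rm m_infty r_star /\ is_lim rm p_infty r_H) /\
         (forall t0 : R,
            precisely_two_solutions M lambda t0 r0
              (time_translate (- t0) rp) (time_translate (- t0) rm))) /\
    (forall r0 : R, r_star < r0 ->
       exists Rp Rm : R -> R,
         precisely_two_solutions M lambda 0 r0 Rp Rm /\
         is_time_reflection Rm Rp /\
         is_time_translation Rp Rp_star /\
         (strict_increasing Rp /\
          is_lim Rp m_infty r_star /\ is_lim Rp p_infty p_infty) /\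
         (strict_decreasing Rm /\
          is_lim Rm m_infty p_infty /\ is_lim Rm p_infty r_star) /\
         (forall t0 : R,
            precisely_two_solutions M lambda t0 r0
              (time_translate (- t0) Rp) (time_translate (- t0) Rm))).
Proof.
  destruct hM as (Hin & Hout & HrH & (F & HF & _ & HF0 & F' & HF' & _) & Hlim
                  & _ & Hstar & _ & Hmax & _).
  assert (Hrad : forall x, radii M x <-> r_H < x).
  { intros x; unfold radii, open_interval; rewrite Hin, Hout; simpl; tauto. }
  apply Hrad in Hstar.
  set (f := metric_coef M); set (rhs := ode_rhs M lambda).
  assert (Hf : forall x, r_H < x -> 0 < f x)
    by (intros x Hx; now apply metric_coef_pos, Hrad).
  assert (Hlam : 0 < lambda ^ 2).
  { rewrite hlambda; apply Rdiv_lt_0_compat; [now apply Hf | apply pow_lt; lra]. }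
  assert (Hden : forall x, r_H < x -> 0 < lambda ^ 2 * x ^ 2)
    by (intros x Hx; apply Rmult_lt_0_compat; [lra | apply pow_lt; lra]).
  assert (Hfv : forall x, r_H < x -> f x = v M x * x ^ 2)
    by (intros x Hx; unfold v, f; field; lra).
  assert (Hrhs : forall x, r_H < x ->
            rhs x = f x ^ 2 * ((lambda ^ 2 * x ^ 2 - f x) / (lambda ^ 2 * x ^ 2))).
  { intros x Hx; unfold rhs, ode_rhs, Rdiv; apply Rmult_assoc. }
  assert (Hrhs_star : rhs r_star = 0).
  { rewrite (Hrhs r_star Hstar), (Hfv r_star Hstar), hlambda.
    unfold Rdiv; ring. }
  (* Here the maximum enters: [lambda ^ 2 * x ^ 2 - f x = (v M r_star - v M x) * x ^ 2]. *)
  assert (Hrhs_pos : forall x, r_H < x -> x <> r_star -> 0 < rhs x).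
  { intros x Hx Hne; rewrite (Hrhs x Hx).
    apply Rmult_lt_0_compat; [now apply pow_lt, Hf |].
    apply Rdiv_lt_0_compat; [| now apply Hden].
    rewrite (Hfv x Hx), hlambda.
    specialize (Hmax x (proj2 (Hrad x) Hx) Hne).
    assert (0 < x ^ 2) by (apply pow_lt; lra); nra. }
  assert (Hrhs_nonneg : forall x, r_H < x -> 0 <= rhs x).
  { intros x Hx; destruct (Req_dec x r_star) as [-> | Hne].
    - rewrite Hrhs_star; lra.
    - now apply Rlt_le, Hrhs_pos. }
  (* [rhs x] is [f x ^ 2] times [1 - f x / (lambda ^ 2 * x ^ 2)], a factor at most 1. *)
  assert (Hspeed : forall x, r_H < x -> sqrt (rhs x) <= f x).
  { intros x Hx; specialize (Hf x Hx); specialize (Hden x Hx).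
    rewrite <- (sqrt_pow2 (f x)) by lra; apply sqrt_le_1_alt.
    rewrite (Hrhs x Hx).
    apply Rle_trans with (f x ^ 2 * 1); [| lra].
    apply Rmult_le_compat_l; [apply pow2_ge_0 |].
    apply Rle_div_l; lra. }
  assert (Hrhs_smooth : forall k, differentiable_upto k (radii M) rhs).
  { intros k; pose proof (metric_coef_smooth M) as Hs.
    apply (smooth_on_differentiable_upto k) in Hs.
    assert (Hq : differentiable_upto k (radii M) (fun x => lambda ^ 2 * x ^ 2)).
    { simpl; repeat apply differentiable_upto_mult;
        first [apply differentiable_upto_const | apply differentiable_upto_id]. }
    unfold rhs, ode_rhs, Rdiv; apply differentiable_upto_mult.
    - apply differentiable_upto_mult;
        [| now apply differentiable_upto_minus].
      simpl; repeat apply differentiable_upto_mult;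
        first [apply differentiable_upto_const | exact Hs].
    - apply differentiable_upto_inv; [| exact Hq].
      intros x Hx; apply Rgt_not_eq, Hden, Hrad, Hx. }
  destruct (quadratic_bound_at_zero_minimum (radii M) rhs r_star)
    as (d & K & Hd & HK & Hquad); auto.
  { apply open_open_interval. }
  { intros x Hx; apply Hrhs_nonneg, Hrad, Hx. }
  { now apply Hrad. }
  assert (Hstay : forall a b q s t, local_C1_solution M lambda a b q ->
            open_interval a b s -> open_interval a b t ->
            q s = r_star -> q t = r_star).
  { intros a b q s t Hq Hs Ht Hqs.
    apply (solution_constant_at_double_zero a b rhs q r_star d K s t); auto.
    - intros x Hx; now apply Hquad.
    - intros x Hx; destruct (Hq x Hx) as (H1 & H2 & _ & H3); auto. }
  (* [K + 1] dominates [sqrt K] and, unlike [K], is certainly positive, as the divergence lemmas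
     demand. *)
  assert (Hspeed_star : forall x, Rabs (x - r_star) < d ->
            sqrt (rhs x) <= (K + 1) * Rabs (x - r_star)).
  { intros x Hx; destruct (Hquad x Hx) as [_ Hle].
    pose proof (Rabs_pos (x - r_star)).
    rewrite <- (sqrt_pow2 ((K + 1) * Rabs (x - r_star))) by nra.
    apply sqrt_le_1_alt; rewrite Rpow_mult_distr, pow2_abs.
    pose proof (pow2_ge_0 (x - r_star)); nra. }
  assert (Hsmooth : forall (a b : Rbar),
            (forall x, open_interval a b x -> r_H < x /\ x <> r_star) ->
            forall k, differentiable_upto k (open_interval a b)
                        (fun x => sqrt (rhs x))).
  { intros a b Hab k; apply differentiable_upto_sqrt.
    - intros x Hx; now apply Hrhs_pos; apply Hab.
    - apply differentiable_upto_subset with (radii M); [| apply Hrhs_smooth].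
      intros x Hx; apply Hrad; now apply Hab. }
  assert (Hflow : forall (a b : Rbar) c, open_interval a b c ->
            (forall x, open_interval a b x -> r_H < x /\ x <> r_star) ->
            (forall T, (forall x, open_interval a b x ->
                          is_derive T x (/ sqrt (rhs x))) ->
               forall y, (exists x, open_interval a b x /\ T x < y) /\
                         (exists x, open_interval a b x /\ y < T x)) ->
            exists T r, flow_through a b (fun x => sqrt (rhs x)) T r).
  { intros a b c Hc Hab Hunb; apply flow_exists with c; auto.
    - intros x Hx; apply sqrt_lt_R0; now apply Hrhs_pos; apply Hab.
    - intros x Hx; destruct (Hsmooth a b Hab 1%nat) as [g' [Hg' _]].
      apply (ex_derive_continuous (fun x => sqrt (rhs x))).
      exists (g' x); now apply Hg'. }
  assert (Hspeed_pos : forall x, r_H < x -> x <> r_star -> 0 < sqrt (rhs x))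
    by (intros x Hx Hne; now apply sqrt_lt_R0, Hrhs_pos).
  split.
  { intros t0; split; [| split; [reflexivity |]].
    - split.
      + apply differentiable_upto_smooth_on; [apply open_true |].
        intros k; apply differentiable_upto_const.
      + intros t; split; [now apply Hrad |].
        change (Derive (fun _ => r_star) t ^ 2 = rhs r_star).
        rewrite Derive_const, Hrhs_star; ring.
    - intros a b q Ht0 Hq Hq0 t Ht; exact (Hstay a b q t0 t Hq Ht0 Ht Hq0). }
  assert (Hinner : forall x, open_interval r_H r_star x -> r_H < x /\ x <> r_star)
    by (intros x [H1 H2]; simpl in *; lra).
  assert (Houter : forall x, open_interval r_star p_infty x ->
            r_H < x /\ x <> r_star)
    by (intros x [H1 _]; simpl in *; lra).
  destruct (Hflow r_H r_star ((r_H + r_star) / 2)) as (T1 & r1 & Hflow1);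
    [split; simpl; lra | exact Hinner | |].
  { intros T HT y; split.
    - destruct (linear_bound_right_of_zero F F' r_H HF' HF0)
        as (dH & C & HdH & HC & Hlin).
      (* Halving makes both bounds strict: [r_H + w] still lies below [r_star] and within reach of
         the linear bound. *)
      set (w := Rmin dH (r_star - r_H) / 2).
      assert (Hw : 0 < w < dH /\ w < r_star - r_H).
      { pose proof (Rmin_l dH (r_star - r_H)).
        pose proof (Rmin_r dH (r_star - r_H)).
        pose proof (Rmin_glb_lt dH (r_star - r_H) 0 ltac:(lra) ltac:(lra)).
        unfold w; lra. }
      destruct (unbounded_below_at_finite_end r_H (r_H + w) C
                  (fun x => sqrt (rhs x)) T) with (y := y) as [x [Hx Hy]];
        try lra.
      + intros x Hx; split; [apply Hspeed_pos; lra |].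
        apply Rle_trans with (f x); [apply Hspeed; lra |].
        unfold f; rewrite <- HF by lra; apply Hlin; lra.
      + intros x Hx; apply HT; split; simpl; lra.
      + exists x; split; [split; simpl; lra | exact Hy].
    - set (w := Rmin d (r_star - r_H) / 2).
      assert (Hw : 0 < w < d /\ w < r_star - r_H).
      { pose proof (Rmin_l d (r_star - r_H)).
        pose proof (Rmin_r d (r_star - r_H)).
        pose proof (Rmin_glb_lt d (r_star - r_H) 0 ltac:(lra) ltac:(lra)).
        unfold w; lra. }
      destruct (unbounded_above_at_finite_end (r_star - w) r_star (K + 1)
                  (fun x => sqrt (rhs x)) T) with (y := y) as [x [Hx Hy]];
        try lra.
      + intros x Hx; split; [apply Hspeed_pos; lra |].
        replace (r_star - x) with (Rabs (x - r_star))
          by (rewrite Rabs_left; lra).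
        apply Hspeed_star; rewrite Rabs_left; lra.
      + intros x Hx; apply HT; split; simpl; lra.
      + exists x; split; [split; simpl; lra | exact Hy]. }
  destruct (Hflow r_star p_infty (r_star + 1)) as (T2 & r2 & Hflow2);
    [split; simpl; [lra | exact I] | exact Houter | |].
  { intros T HT y; split.
    - destruct (unbounded_below_at_finite_end r_star (r_star + d / 2) (K + 1)
                  (fun x => sqrt (rhs x)) T) with (y := y) as [x [Hx Hy]];
        try lra.
      + intros x Hx; split; [apply Hspeed_pos; lra |].
        rewrite <- (Rabs_right (x - r_star)) by lra.
        apply Hspeed_star; rewrite Rabs_right; lra.
      + intros x Hx; apply HT; split; simpl; [lra | exact I].
      + exists x; split; [split; simpl; [lra | exact I] | exact Hy].
    (* Tolerance 1 around the limit 1 of [f] gives [f < 2] beyond [N], whence the speed bound 2. *)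
    - apply is_lim_spec in Hlim; destruct (Hlim (mkposreal 1 Rlt_0_1)) as [N HN].
      simpl in HN.
      set (p := Rmax N r_star + 1).
      assert (Hp : N < p /\ r_star < p).
      { pose proof (Rmax_l N r_star); pose proof (Rmax_r N r_star).
        unfold p; lra. }
      destruct (unbounded_above_at_infinity p 2
                  (fun x => sqrt (rhs x)) T) with (y := y) as [x [Hx Hy]];
        try lra.
      + intros x Hx; split; [apply Hspeed_pos; lra |].
        apply Rle_trans with (f x); [apply Hspeed; lra |].
        specialize (HN x ltac:(lra)); apply Rabs_def2 in HN.
        unfold f; lra.
      + intros x Hx; apply HT; split; simpl; [lra | exact I].
      + exists x; split; [split; simpl; [lra | exact I] | exact Hy]. }
  (* [Hstay] with the two times exchanged: being at [r_star] at time [t] would force the same at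
     time [s]. *)
  assert (Hne : forall a b q s t, local_C1_solution M lambda a b q ->
            open_interval a b s -> open_interval a b t ->
            q s <> r_star -> q t <> r_star)
    by (intros a b q s t Hq Hs Ht Hqs Hqt; eauto).
  assert (Hcont : forall a b q t, local_C1_solution M lambda a b q ->
            open_interval a b t -> continuous (fun t => q t - r_star) t).
  { intros a b q t Hq Ht; apply (continuous_minus q (fun _ => r_star)).
    - apply (ex_derive_continuous q); now apply Hq.
    - apply continuous_const. }
  destruct (flow_solutions M lambda r_H r_star T1 r1) as [Hr1 Hall1]; auto.
  { intros x Hx; apply Hrad; now apply Hinner. }
  { intros a b q s t Hq Hs Ht [Hs1 Hs2]; simpl in Hs1, Hs2.
    (* The lower end is part of what a local solution is, by [radii M (q t)]; the upper end is the
       sign of [q - r_star]. *)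
    split; simpl; [now apply Hrad, (Hq t) |].
    enough (0 < - (q t - r_star)) by lra.
    apply (nonvanishing_same_sign a b (fun t => - (q t - r_star)) s t); auto;
      [| | lra]; intros x Hx.
    - apply (continuous_opp (fun t => q t - r_star)); eauto.
    - assert (q x <> r_star) by (apply (Hne a b q s x); auto; lra); lra. }
  destruct (flow_solutions M lambda r_star p_infty T2 r2) as [Hr2 Hall2]; auto.
  { intros x Hx; apply Hrad; now apply Houter. }
  { intros a b q s t Hq Hs Ht [Hs1 _]; simpl in Hs1.
    split; simpl; [| exact I].
    enough (0 < q t - r_star) by lra.
    apply (nonvanishing_same_sign a b (fun t => q t - r_star) s t); auto;
      [| | lra]; intros x Hx.
    - eauto.
    - assert (q x <> r_star) by (apply (Hne a b q s x); auto; lra); lra. }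
  exists r1, r2; split; [exact Hr1 | split; [exact Hr2 | split]].
  - intros r0 Hr0; exact (Hall1 r0 Hr0).
  - intros r0 Hr0; exact (Hall2 r0 (conj Hr0 I)).
Qed.
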